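(* Let $\mathcal{T}^d=(\mathcal{N},\mathcal{E},d)$ be a tree diagram and let $L_1(\mathcal{T}^d)$ be the associated upward solvable Lie algebra of differential operators. Then any maximal abelian ideal of $L_1(\mathcal{T}^d)$ is of the form $I(S)$ for some maximal independent subset $S$ of $\Upsilon$.
   Context: A tree $\mathcal{T}=(\mathcal{N},\mathcal{E})$ consists of a finite set of nodes $\mathcal{N}=\{\iota_1,\ldots,\iota_n\}$ and a set of edges $\mathcal{E}\subset\{(\iota_i,\iota_j)\mid 1\le i<j\le n\}$ such that for each node $\iota_i$ there is a unique sequence $\mathcal{C}_i=\{\iota_{i_1},\ldots,\iota_{i_r}\}$ of nodes with $1=i_1<i_2<\cdots<i_r=i$ and $(\iota_{i_s},\iota_{i_{s+1}})\in\mathcal{E}$ for $1\le s\le r-1$; $\mathcal{C}_i$ is called the clan of $\iota_i$ (so $\mathcal{C}_1=\{\iota_1\}$). A tree diagram $\mathcal{T}^d=(\mathcal{N},\mathcal{E},d)$ is a tree with a map $d:\mathcal{E}\to\{1,2,3,\ldots\}$. Let $\mathbb{A}$ be the associative algebra of differential operators in $x_1,\ldots,x_n$ with coefficients in $\mathbb{C}[x_1,\ldots,x_n]$, with Lie bracket $[A,B]=AB-BA$; write $\partial_{x_i}=\partial/\partial x_i$. Let $L_0(\mathcal{T}^d)$ be the Lie subalgebra of $\mathbb{A}$ generated by $\partial_{x_1}$ and all $x_i^{d[(\iota_i,\iota_j)]}\partial_{x_j}$ with $(\iota_i,\iota_j)\in\mathcal{E}$. Let $H=\sum_{i=1}^n\mathbb{C}x_i\partial_{x_i}$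 and $L_1(\mathcal{T}^d)=H+L_0(\mathcal{T}^d)$. For $2\le i\le n$ with $\mathcal{C}_i=\{\iota_{i_1},\ldots,\iota_{i_r}\}$, let $$R_i=\Big\{(j_1,\ldots,j_{r-1})\in\mathbb{N}^{r-1}\ \Big|\ j_1+\sum_{s=2}^{r-1}j_s\,d[(\iota_{i_1},\iota_{i_2})]\cdots d[(\iota_{i_{s-1}},\iota_{i_s})]\le d[(\iota_{i_1},\iota_{i_2})]\cdots d[(\iota_{i_{r-1}},\iota_{i_r})]\Big\},$$ where $\mathbb{N}=\{0,1,2,\ldots\}$, and for $\vec j=(j_1,\ldots,j_{r-1})\in R_i$ put $x^{\vec j}=x_{i_1}^{j_1}\cdots x_{i_{r-1}}^{j_{r-1}}$. Also $R_1=\{0\}$ and $x^0=1$. A node $\iota_i$ is multiplicity-free if there is $j<i$ with $(\iota_j,\iota_i)\in\mathcal{E}$ and $d[(\iota_j,\iota_i)]=1$. A node $\iota_j$ is a descendant of $\iota_i$ if $i<j$ and $\iota_i\in\mathcal{C}_j$; $\mathcal{D}_i$ is the set of all descendants of $\iota_i$. Put $\Upsilon=\{\iota_i\in\mathcal{N}\mid \iota_j\text{ is multiplicity-free for every }\iota_j\in\mathcal{D}_i\}$. A set $S$ of nodes is independent if no element of $S$ is a descendant of another element of $S$; a maximal independent subset of $\Upsilon$ is an independent subset of $\Upsilon$ that is maximal with respect to inclusion. For an independent subset $S$ of $\Upsilon$, $$I(S)=\mathrm{Span}\{x^{\vec j}\partial_{x_i},\ x^{\vec j}\partial_{x_s}\mid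 \iota_i\in S,\ \vec j\in R_i,\ \iota_s\in\mathcal{D}_i\}.$$ A maximal abelian ideal is an abelian ideal that is maximal with respect to inclusion among abelian ideals. *)

(* Defs.v *)
From mathcomp Require Import all_boot all_order all_algebra.
From mathcomp Require Import boolp classical_sets functions reals complex.
From mathcomp Require Import mpoly.

Set Implicit Arguments.
Unset Strict Implicit.
Unset Printing Implicit Defensive.

Import GRing.Theory.

Local Open Scope ring_scope.
Local Open Scope classical_set_scope.

(** * Tree diagrams *)

(* [c] is a sequence root = i_1 < ... < i_r = i with consecutive edges. *)
Definition is_clan (n : nat) (e : rel 'I_n.+1) (i : 'I_n.+1)
    (c : seq 'I_n.+1) : bool :=
  if c is x :: p then
    [&& x == ord0, path (fun u v : 'I_n.+1 => (u < v)%N && e u v) x p & last x p == i]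
  else false.

(* The node iota_(k+1) is the ordinal k, so the root iota_1 is [ord0].
   [mult] is the map d; its values outside [edge] are irrelevant. *)
Record tree_diagram (n : nat) := TreeDiagram {
  edge : rel 'I_n.+1;
  edge_lt : forall i j, edge i j -> (i < j)%N;
  clan_unique : forall i, exists! c, is_clan edge i c;
  mult : 'I_n.+1 -> 'I_n.+1 -> nat;
  mult_gt0 : forall i j, edge i j -> (0 < mult i j)%N
}.

Lemma clan_exists (n : nat) (T : tree_diagram n) (i : 'I_n.+1) :
  exists c, is_clan (edge T) i c.
Proof. by have [c [hc _]] := clan_unique T i; exists c. Qed.

Section Combinatorics.
Variables (n : nat) (T : tree_diagram n).
Implicit Types (i j : 'I_n.+1) (S : {set 'I_n.+1}) (a : seq nat).

Definition clan i : seq 'I_n.+1 := xchoose (clan_exists T i).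

Definition multiplicity_free i : bool :=
  [exists j : 'I_n.+1, [&& (j < i)%N, edge T j i & mult T j i == 1%N]].

Definition descendants i : {set 'I_n.+1} :=
  [set j : 'I_n.+1 | (i < j)%N && (i \in clan j)]%SET.

Definition Upsilon : {set 'I_n.+1} :=
  [set i | [forall j in descendants i, multiplicity_free j]]%SET.

Definition independent S : bool :=
  [forall i in S, forall j in S, j \notin descendants i].

Definition maximal_independent_Upsilon S : bool :=
  maxset (fun S' => independent S' && (S' \subset Upsilon)) S.

(* d[(i_1,i_2)] ... d[(i_s,i_(s+1))] along the clan of [i]. *)
Definition clan_mult i (s : nat) : nat :=
  (\prod_(t < s) mult T (nth ord0 (clan i) t) (nth ord0 (clan i) t.+1))%N.

(* The exponent j_(s+1) is [nth 0 a s].  The clan of the root has length 1, so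
   R_1 consists of the empty exponent vector only, whose monomial is 1. *)
Definition exponents i a : bool :=
  (size a == (size (clan i)).-1) &&
  (\sum_(s < size a) nth 0 a s * clan_mult i s
     <= clan_mult i (size (clan i)).-1)%N.

End Combinatorics.

(** * Lie algebras of differential operators *)

(* Differential operators are identified with their action on polynomials
   (a faithful action in characteristic 0).  Their associative product is the
   composition [\o]; addition and scaling are pointwise. *)
Notation operator K n := ({mpoly K[n]} -> {mpoly K[n]}).

Section Operators.
Variables (K : fieldType) (n : nat).
Local Notation op := (operator K n).
Implicit Types (D E : op) (V G L I : set op).

(* The operators sum_a c_a d^a with polynomial coefficients c_a. *)
Definition diffops : set op :=
  [set D | exists c : {mpoly {mpoly K[n]}[n]},
     D = fun p => \sum_(a <- msupp c) c@_a * mderivm a p].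

Definition vfield (f : {mpoly K[n]}) (i : 'I_n) : op :=
  fun p => f * mderiv i p.

Definition bracket D E : op := (D \o E) - (E \o D).

Definition subspace V : Prop :=
  V 0 /\ forall (k : K) D E, V D -> V E -> V (k *: D + E).

Definition span G : set op :=
  [set D | forall V, subspace V -> G `<=` V -> V D].

Definition lie_subalgebra L : Prop :=
  [/\ L `<=` diffops, subspace L &
      forall D E, L D -> L E -> L (bracket D E)].

Definition lie_generated G : set op :=
  [set D | forall L, lie_subalgebra L -> G `<=` L -> L D].

Definition abelian_ideal L I : Prop :=
  [/\ I `<=` L, subspace I,
      forall D E, L D -> I E -> I (bracket D E) &
      forall D E, I D -> I E -> bracket D E = 0].

Definition maximal_abelian_ideal L I : Prop :=
  abelian_ideal L I /\
  forall I', abelian_ideal L I' -> I `<=` I' -> I' = I.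

End Operators.

Section TreeLieAlgebras.
Variables (K : fieldType) (n : nat) (T : tree_diagram n).

Definition L0 : set (operator K n.+1) :=
  lie_generated ([set vfield 1 ord0] `|`
    [set D | exists i j, edge T i j /\ D = vfield ('X_i ^+ mult T i j) j]).

Definition H : set (operator K n.+1) :=
  span [set D | exists i, D = vfield 'X_i i].

Definition L1 : set (operator K n.+1) :=
  [set D | exists D1 D2, [/\ H D1, L0 D2 & D = D1 + D2]].

Definition clan_monomial (i : 'I_n.+1) (a : seq nat) : {mpoly K[n.+1]} :=
  \prod_(s < size a) 'X_(nth ord0 (clan T i) s) ^+ nth 0%N a s.

Definition ideal_of (S : {set 'I_n.+1}) : set (operator K n.+1) :=
  span [set D | exists i a s,
    [/\ i \in S, exponents T i a, s = i \/ s \in descendants T i &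
        D = vfield (clan_monomial i a) s]].

End TreeLieAlgebras.

(* Main.v *)
Require Import Defs.
From mathcomp Require Import all_boot all_order all_algebra.
From mathcomp Require Import boolp classical_sets functions reals complex.
From mathcomp Require Import ssrcomplements mpoly zify.

(** Give the variable x_i of a node the weight w(i), the product of the
    multiplicities along its clan.  The Lie algebra L_0 is then spanned by the
    fields x^m d_i in which x^m involves only strict ancestors of i and has weight
    at most w(i): these are closed under bracket, and they are obtained from the
    generators by splitting x^m into pieces, which is possible because the weights
    along a clan divide one another ([monomial_split], [L0E]).

    Let I be an abelian ideal of L_1.  It is stable under the Euler operators
    x_k d_k, which separate the monomial fields x^m d_i from one another, so I is
    the span of an Euler part and of the x^m d_i that it contains; since
    all d_i are in L_1, commutativity excludes the Euler part
    ([monf_mem_of_weight], [ideal_coef]).  Let P be the set of nodes i with d_i in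
    I.  Every x^m d_i in I has i in P, as repeated differentiation shows, and x^m
    involves no variable of P, as I is abelian.  Bracketing with x_i d_s shows
    that P is closed under descendants, and bracketing with x_p^d d_s that d = 1
    for every edge that starts in P ([partials_descendants], [partials_Upsilon]).
    So the set S of the topmost nodes of P is an independent subset of Upsilon,
    and the two facts on x^m say that I is contained in I(S)
    ([abelian_ideal_sub]).

    Conversely, I(S) is an abelian ideal for every independent subset S of Upsilon
    ([ideal_of_abelian]), because weights are constant below a node of Upsilon.
    When I is maximal this gives I = I(S), and S is maximal because S is determined
    by I(S) among the independent sets that contain it ([ideal_of_inj_sub]). *)

Set Implicit Arguments.
Unset Strict Implicit.
Unset Printing Implicit Defensive.

Import GRing.Theory Num.Theory Defs.

Local Open Scope ring_scope.
Local Open Scope classical_set_scope.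

(** * Polynomial vector fields *)

Section VectorFields.
Variables (K : fieldType) (n : nat).
Local Notation op := (operator K n).
Implicit Types (F G : 'I_n -> {mpoly K[n]}) (f g p : {mpoly K[n]}).
Implicit Types (i j k s : 'I_n) (a b m : 'X_{1..n}) (D E : op) (V : set op).
Implicit Types P Q R : 'I_n -> 'X_{1..n} -> Prop.

(** The derivation with coefficients F: in coordinates, every operator met below
    has this form, and F is recovered by letting it act on the variables. *)
Definition vf F : op := fun p => \sum_i F i * mderiv i p.

Definition monf a i : op := vfield 'X_[a] i.

(** All Lie algebras and ideals below are spanned by some of the monomial fields
    x^m d_i, so each is given by a predicate on the pairs (i, m), and closure
    properties become statements about exponents. *)
Definition vfields_on P : set op :=
  [set D | exists2 F, D = vf F & forall i m, (F i)@_m != 0 -> P i m].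

Lemma vf_ext F G : F =1 G -> vf F = vf G.
Proof. by move=> FG; apply: funext => p; apply: eq_bigr => i _; rewrite FG. Qed.

(** This makes coefficients well defined: a field determines its F. *)
Lemma vf_X F i : vf F 'X_i = F i.
Proof.
rewrite /vf (bigD1 i) //= mderivX mnm1E eqxx scale1r.
have ->: (U_(i) - U_(i) = 0 :> 'X_{1..n})%MM.
  by apply/mnmP=> j; rewrite mnmBE mnm0E subnn.
rewrite mpolyX0 mulr1 big1 ?addr0 // => j ji.
by rewrite mderivX mnm1E eq_sym (negbTE ji) scale0r mulr0.
Qed.

Lemma vf_inj F G : vf F = vf G -> F =1 G.
Proof. by move=> FG i; rewrite -vf_X FG vf_X. Qed.

Lemma vf_linear c F G : c *: vf F + vf G = vf (fun i => c *: F i + G i).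
Proof.
apply: funext => p; rewrite /vf !fctE scaler_sumr -big_split.
by apply: eq_bigr => i _; rewrite mulrDl scalerAl.
Qed.

Lemma vfieldE f i : vfield f i = vf (fun j => if j == i then f else 0).
Proof.
apply: funext => p; rewrite /vf /vfield (bigD1 i) //= eqxx big1 ?addr0 // => j.
by move=> /negbTE ->; rewrite mul0r.
Qed.

(** The second-order terms of the two compositions are equal by the symmetry of
    iterated partial derivatives, so a commutator of derivations is a derivation. *)
Lemma bracket_vf F G :
  bracket (vf F) (vf G) = vf (fun i => vf F (G i) - vf G (F i)).
Proof.
apply: funext => p; rewrite /bracket /= !fctE.
have comp F1 F2 : vf F1 (vf F2 p) = \sum_i vf F1 (F2 i) * mderiv i p +
    \sum_i \sum_j F1 i * F2 j * mderiv i (mderiv j p).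
  rewrite {1 3}/vf; under eq_bigr => i _.
    rewrite {1}/vf linear_sum mulr_sumr /=; under eq_bigr => j _.
      rewrite mderivM mulrDr mulrA (mulrA (F1 i)); over.
    rewrite big_split; over.
  rewrite big_split exchange_big; congr (_ + _).
  by apply: eq_bigr => i _; rewrite /vf mulr_suml.
rewrite !comp [X in _ - (_ + X)]exchange_big /=.
have -> : \sum_j \sum_i G i * F j * mderiv i (mderiv j p) =
          \sum_i \sum_j F i * G j * mderiv i (mderiv j p).
  apply: eq_bigr => i _; apply: eq_bigr => j _.
  by rewrite mderiv_comm (mulrC (G _)).
rewrite opprD addrACA subrr addr0 -sumrB.
by apply: eq_bigr => i _; rewrite mulrBl.
Qed.

Lemma mcoeff_mul_deriv_neq0 f g i m : (f * mderiv i g)@_m != 0 ->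
  exists a b, [/\ m = (a + b)%MM, f@_a != 0 & g@_(b + U_(i)) != 0].
Proof.
rewrite -mcoeff_msupp => /msuppM_le /allpairsP[[a b] /= [fa gb ->]].
exists a, b; split; rewrite // -?mcoeff_msupp //.
move: gb; rewrite !mcoeff_msupp mcoeff_deriv; apply: contra => /eqP ->.
by rewrite mul0rn.
Qed.

Lemma vf_neq0 F g m : (vf F g)@_m != 0 ->
  exists i a b, [/\ m = (a + b)%MM, (F i)@_a != 0 & g@_(b + U_(i)) != 0].
Proof.
rewrite /vf raddf_sum /= => h.
have [i hi] : exists i, (F i * mderiv i g)@_m != 0.
  apply: contra_neqP h => /forallNP h; rewrite big1 // => i _.
  by apply/eqP; move/negP: (h i); rewrite negbK.
by exists i; have [a [b]] := mcoeff_mul_deriv_neq0 hi; exists a, b.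
Qed.

(** A term of f d_i g comes from terms x^a of f and x^(b + U_i) of g and is a
    multiple of x^(a + b).  Writing the exponent in g as b + U_i avoids a
    truncated subtraction and records that x_i divides it. *)
Lemma bracket_vfields_on P Q R D E :
    (forall i a s b, P i a -> Q s (b + U_(i))%MM -> R s (a + b)%MM) ->
    (forall i a s b, Q i a -> P s (b + U_(i))%MM -> R s (a + b)%MM) ->
  vfields_on P D -> vfields_on Q E -> vfields_on R (bracket D E).
Proof.
move=> PQ QP [F -> FP] [G -> GQ]; rewrite bracket_vf; eexists; first by [].
move=> s m /=; rewrite mcoeffB => h.
have [/vf_neq0[i [a [b [-> /FP Fa /GQ Gb]]]]|FG0] :=
    boolP ((vf F (G s))@_m != 0).
  exact: PQ Fa Gb.
move: h; rewrite negbK in FG0; rewrite (eqP FG0) sub0r oppr_eq0.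
by move=> /vf_neq0[i [a [b [-> /GQ Ga /FP Fb]]]]; exact: QP Ga Fb.
Qed.

Lemma subspace_vfields_on P : subspace (vfields_on P).
Proof.
split=> [|c D E [F -> FP] [G -> GP]].
  exists (fun=> 0) => [|i m]; last by rewrite mcoeff0 eqxx.
  by apply: funext => p; rewrite /vf big1 // => i _; rewrite mul0r.
exists (fun i => c *: F i + G i); first exact: vf_linear.
move=> i m; rewrite mcoeffD mcoeffZ.
have [/FP //|/negPn/eqP ->] := boolP ((F i)@_m != 0).
by rewrite mulr0 add0r => /GP.
Qed.

Lemma vfields_onS P Q :
  (forall i m, P i m -> Q i m) -> vfields_on P `<=` vfields_on Q.
Proof. by move=> PQ D [F -> FP]; exists F => // i m /FP/PQ. Qed.

Lemma subspaceD V D E : subspace V -> V D -> V E -> V (D + E).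
Proof. by case=> _ VL VD VE; have := VL 1 D E VD VE; rewrite scale1r. Qed.

Lemma subspaceZ V c D : subspace V -> V D -> V (c *: D).
Proof. by case=> V0 VL VD; have := VL c D 0 VD V0; rewrite addr0. Qed.

Lemma subspaceZ_neq0 V c D : subspace V -> c != 0 -> V (c *: D) -> V D.
Proof.
by move=> sV c0 /(subspaceZ c^-1 sV); rewrite scalerA mulVf // scale1r.
Qed.

Lemma subspace_sum V (J : eqType) (r : seq J) (D_ : J -> op) :
  subspace V -> (forall x, x \in r -> V (D_ x)) -> V (\sum_(x <- r) D_ x).
Proof.
move=> sV h; rewrite big_seq; apply: big_ind => //; first by case: sV.
by move=> D E; exact: subspaceD.
Qed.

Lemma subspace_span (A : set op) : subspace (span A).
Proof.
split=> [V [] //|c D E AD AE V sV AV].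
by case: (sV) => _; apply; [exact: AD|exact: AE].
Qed.

Lemma sub_span (A : set op) : A `<=` span A.
Proof. by move=> D AD V _; apply. Qed.

Lemma vf_monf F : vf F = \sum_i \sum_(m <- msupp (F i)) (F i)@_m *: monf m i.
Proof.
apply: funext => p; rewrite fct_sumE; apply: eq_bigr => i _.
rewrite {1}[F i]mpolyE fct_sumE mulr_suml; apply: eq_bigr => m _.
by rewrite /monf /vfield !fctE scalerAl.
Qed.

Lemma vf_in_subspace V F : subspace V ->
  (forall i m, (F i)@_m != 0 -> V (monf m i)) -> V (vf F).
Proof.
move=> sV h; rewrite vf_monf; apply: subspace_sum => // i _.
apply: subspace_sum => // m; rewrite mcoeff_msupp => Fm.
by apply: subspaceZ => //; exact: h.
Qed.

Lemma vfields_on_sub P V : subspace V ->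
  (forall i m, P i m -> V (monf m i)) -> vfields_on P `<=` V.
Proof. by move=> sV h _ [F -> FP]; apply: vf_in_subspace => // i m /FP/h. Qed.

Lemma monf_in P m i : P i m -> vfields_on P (monf m i).
Proof.
move=> Pim; rewrite /monf vfieldE; eexists; first by [].
move=> j b; have [->|/negbTE ji] := eqVneq j i; last by rewrite ?ji mcoeff0 eqxx.
by rewrite ?eqxx mcoeffX; case: (m =P b) => [<-|] //; rewrite eqxx.
Qed.

Lemma monf_inv P m i : vfields_on P (monf m i) -> P i m.
Proof.
rewrite /monf vfieldE => -[F /vf_inj Fm]; apply; rewrite -Fm eqxx.
by rewrite mcoeffX eqxx oner_eq0.
Qed.

Lemma span_monf P :
  span [set D | exists i m, P i m /\ D = monf m i] = vfields_on P.
Proof.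
apply/seteqP; split=> [D|]; last first.
  apply: vfields_on_sub; first exact: subspace_span.
  by move=> i m Pim; apply: sub_span; exists i, m.
apply; first exact: subspace_vfields_on.
by move=> _ [i [m [Pim ->]]]; exact: monf_in.
Qed.

Lemma bracket_skew D E : bracket D E = - bracket E D.
Proof. by rewrite /bracket opprB. Qed.

(** As x_s does not occur in x^a, the second half of the commutator vanishes. *)
Lemma bracket_monf a b i s : a s = 0%N ->
  bracket (monf a i) (monf (b + U_(i)) s) = (b i).+1%:R *: monf (a + b)%MM s.
Proof.
move=> as0; rewrite /monf !vfieldE bracket_vf.
have -> (c : K) f : c *: vf (fun j => if j == s then f else 0) =
    vf (fun j => if j == s then c *: f else 0).
  rewrite -!vfieldE; apply: funext => p.
  by rewrite /vfield !fctE scalerAl.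
apply: vf_ext => j; rewrite -!vfieldE /vfield.
have -> : mderiv s (if j == i then 'X_[a] else 0) = 0 :> {mpoly K[n]}.
  by case: ifP => _; rewrite ?mderiv0 // mderivX as0 scale0r.
rewrite mulr0 subr0; case: ifP => _; last by rewrite mderiv0 mulr0.
rewrite mderivX mnmDE mnm1E eqxx addn1 -scalerAr -mpolyXD; congr (_ *: 'X_[_]).
by apply/mnmP => l; rewrite !mnmDE mnmBE mnmDE addnK.
Qed.

(** The generated Lie algebra is an intersection of Lie algebras of differential
    operators, so a candidate containing it must consist of such operators. *)
Lemma diffops_vfields_on P : vfields_on P `<=` @diffops K n.
Proof.
have lin : subspace (@diffops K n).
  split; first by exists 0; apply: funext => p; rewrite msupp0 big_nil.
  move=> k _ _ [c1 ->] [c2 ->]; exists (k%:MP *: c1 + c2).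
  (* Sum both polynomials over one common range of exponents. *)
  have wide (c : {mpoly {mpoly K[n]}[n]}) d : (msize c <= d)%N -> forall p,
    \sum_(a <- msupp c) c@_a * mderivm a p =
    \sum_(m : 'X_{1..n < d}) c@_m * mderivm m p.
    move=> cd p; pose J : subFinType _ := 'X_{1..n < d}.
    rewrite (big_mksub J) /=; first last.
    - by move=> x /msize_mdeg_lt/leq_trans/(_ cd).
    - by rewrite msupp_uniq.
    rewrite big_rmcond //= => j /memN_msupp_eq0 ->.
    by rewrite mul0r.
  apply: funext => p; rewrite !fctE.
  pose d := maxn (msize (k%:MP *: c1 + c2)) (maxn (msize c1) (msize c2)).
  rewrite !(@wide _ d) ?leq_max ?leqnn ?orbT // scaler_sumr -big_split /=.
  apply: eq_bigr => m _; rewrite mcoeffD mcoeffZ mulrDl; congr (_ + _).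
  by rewrite -mulrA mul_mpolyC.
apply: vfields_on_sub => // i m _.
exists ('X_[m] *: 'X_[U_(i)]); apply: funext => p.
have X0 : 'X_[m] != 0 :> {mpoly K[n]} by rewrite -msupp_eq0 msuppX.
by rewrite msuppMCX // big_seq1 mcoeffZ mcoeffX eqxx mulr1 mderivmU1m.
Qed.
End VectorFields.

(** * Weight spaces for the Euler operators *)

Section Weights.
Variables (K : numFieldType) (n : nat).
Local Notation op := (operator K n).
Implicit Types (F G : 'I_n -> {mpoly K[n]}) (f : {mpoly K[n]}).
Implicit Types (i k : 'I_n) (a m : 'X_{1..n}) (V : set op).

(** The eigenvalue of x^m d_i under the adjoint action of x_k d_k. *)
Definition weight i m k : K := (m k)%:R - (k == i)%:R.

Lemma mcoeff_euler f k m : ('X_k * mderiv k f)@_m = (m k)%:R * f@_m.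
Proof.
rewrite [f]mpolyE linear_sum mulr_sumr !raddf_sum mulr_sumr /=.
apply: eq_bigr => a _; rewrite mderivZ mderivX -!scalerAr !mcoeffZ -mpolyXD.
have [a0|a0] := eqVneq (a k) 0%N.
  rewrite a0 mul0r mulr0 mcoeffX; case: (a =P m) => [<-|_]; rewrite ?a0 ?mul0r //.
  by rewrite mulr0 mulr0.
have -> : (U_(k) + (a - U_(k)) = a)%MM.
  by apply/mnmP => l; rewrite mnmDE mnmBE mnm1E; case: eqP => [<-|]; lia.
rewrite mcoeffX; case: (a =P m) => [<-|_]; last by rewrite !mulr0.
by rewrite !mulr1 mulrC.
Qed.

Lemma bracket_euler k F : exists2 G, bracket (monf U_(k)%MM k) (vf F) = vf G
  & forall i m, (G i)@_m = weight i m k * (F i)@_m.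
Proof.
rewrite /monf vfieldE bracket_vf; eexists; first by [].
move=> i m; rewrite -vfieldE /vfield mcoeffB mcoeff_euler mulrBl eq_sym.
have [->|_] := eqVneq i k; first by rewrite vf_X mul1r.
rewrite mul0r; congr (_ - _).
by rewrite /vf big1 ?mcoeff0 // => j _; rewrite mderiv0 mulr0.
Qed.

(** Eigenvectors for distinct weights can be separated inside a stable subspace:
    for each unwanted pair, some ad (x_k d_k) minus a scalar kills it while
    multiplying the wanted pair by a nonzero number. *)
Lemma weight_filter V F i0 m0 (l : seq ('I_n * 'X_{1..n})) :
    subspace V -> (forall k D, V D -> V (bracket (monf U_(k)%MM k) D)) ->
    V (vf F) -> (F i0)@_m0 != 0 ->
    (forall x, x \in l -> exists k, weight x.1 x.2 k != weight i0 m0 k) ->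
  exists G, [/\ V (vf G), (G i0)@_m0 != 0,
    (forall i m, (F i)@_m = 0 -> (G i)@_m = 0) &
    (forall x, x \in l -> (G x.1)@_x.2 = 0)].
Proof.
move=> sV hV VF F0; elim: l => [|x l IHl] hl; first by exists F.
have [|G [VG G0 GF Gl]] := IHl.
  by move=> y yl; apply: hl; rewrite inE yl orbT.
have [|k hk] := hl x; first by rewrite inE eqxx.
have [G1 EG1 cG1] := bracket_euler k G.
have cG' i m : (- weight x.1 x.2 k *: G i + G1 i)@_m =
    (weight i m k - weight x.1 x.2 k) * (G i)@_m.
  by rewrite mcoeffD mcoeffZ cG1 -mulrDl addrC.
exists (fun i => - weight x.1 x.2 k *: G i + G1 i); split.
- rewrite -vf_linear; case: (sV) => _; apply=> //.
  by rewrite -EG1; exact: hV.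
- by rewrite cG' mulf_neq0 // subr_eq0 eq_sym.
- by move=> i m /GF Gim; rewrite cG' Gim mulr0.
- move=> y; rewrite inE cG' => /orP[/eqP ->|/Gl ->]; last by rewrite mulr0.
  by rewrite subrr mul0r.
Qed.

(** Filtering out every other pair of the finite support isolates one monomial
    field. *)
Lemma monf_mem_of_weight V F i0 m0 :
    subspace V -> (forall k D, V D -> V (bracket (monf U_(k)%MM k) D)) ->
    V (vf F) -> (F i0)@_m0 != 0 ->
    (forall i m, (F i)@_m != 0 -> weight i m =1 weight i0 m0 ->
       i = i0 /\ m = m0) ->
  V (monf m0 i0).
Proof.
move=> sV hV VF F0 sep.
pose l := [seq x <- [seq (i, m) | i <- enum 'I_n, m <- msupp (F i)]
           | x != (i0, m0)].
have [|G [VG G0 GF Gl]] := weight_filter (l := l) sV hV VF F0.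
  move=> x; rewrite mem_filter => /andP[xn /allpairsPdep[i [m [_]]]].
  rewrite mcoeff_msupp => Fim xE; apply: contra_neqP xn => /forallNP sw.
  rewrite xE; have [||-> -> //] := sep i m => // k.
  by have /negP := sw k; rewrite negbK xE => /eqP.
have Gz i m : (i, m) != (i0, m0) -> (G i)@_m = 0.
  move=> im; have [/GF//|Fim] := eqVneq (F i)@_m 0.
  apply: (Gl (i, m)); rewrite mem_filter im /=.
  by apply/allpairsPdep; exists i, m; rewrite mem_enum mcoeff_msupp.
apply: (subspaceZ_neq0 (c := (G i0)@_m0)) => //.
suff <- : vf G = (G i0)@_m0 *: monf m0 i0 by [].
rewrite vf_monf (bigD1 i0) //= [X in _ + X]big1 ?addr0; last first.
  move=> i ii0; apply: big1 => m _; rewrite Gz ?scale0r //.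
  by rewrite xpair_eqE (negbTE ii0).
rewrite (bigD1_seq m0) ?msupp_uniq ?mcoeff_msupp //= big1 ?addr0 // => m mm0.
by rewrite Gz ?scale0r // xpair_eqE (negbTE mm0) andbF.
Qed.
End Weights.

(** * Clans, descendants and weights of nodes *)

Section Tree.
Variables (n : nat) (T : tree_diagram n).
Implicit Types (i j k p s : 'I_n.+1) (m : 'X_{1..n.+1}).

Lemma clan_eq i c : is_clan (edge T) i c -> clan T i = c.
Proof.
move=> ic; have [c0 [_ c0u]] := clan_unique T i.
by rewrite -(c0u _ ic) [RHS](c0u _ (xchooseP (clan_exists T i))).
Qed.

Lemma clan_root : clan T ord0 = [:: ord0].
Proof. by apply: clan_eq; rewrite /is_clan /= !eqxx. Qed.

Lemma clan_edge p i : edge T p i -> clan T i = rcons (clan T p) i.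
Proof.
move=> pi; apply: clan_eq; have := xchooseP (clan_exists T p).
rewrite -/(clan T p); case: (clan T p) => //= x c /and3P[-> xc /eqP cp].
by rewrite last_rcons rcons_path xc cp pi (edge_lt pi) eqxx.
Qed.

(** A clan minus its last node is the clan of the parent, so statements about
    nodes can be proved from a parent to its children. *)
Lemma node_ind (P : 'I_n.+1 -> Prop) :
  P ord0 -> (forall p i, edge T p i -> P p -> P i) -> forall i, P i.
Proof.
move=> P0 PS i; have [d] := ubnP (nat_of_ord i); elim: d i => // d IHd i id.
have := xchooseP (clan_exists T i); case: (xchoose _) => //= x c.
case/and3P=> /eqP ->; case/lastP: c => [_ /eqP <- //|c y].
rewrite last_rcons rcons_path => /andP[_ /andP[lt ed]] /eqP yi.
rewrite yi in lt ed.
by apply: PS ed (IHd _ _); exact: leq_trans lt id.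
Qed.

Lemma mem_clan_le i j : j \in clan T i -> (j <= i)%N.
Proof.
elim/node_ind: i => [|p i pi IHp]; first by rewrite clan_root inE => /eqP ->.
rewrite (clan_edge pi) mem_rcons inE => /orP[/eqP -> //|/IHp jp].
exact: leq_trans jp (ltnW (edge_lt pi)).
Qed.

Lemma mem_clan i : i \in clan T i.
Proof.
elim/node_ind: i => [|p i pi _]; first by rewrite clan_root inE.
by rewrite (clan_edge pi) mem_rcons inE eqxx.
Qed.

Lemma clan_size_gt0 i : (0 < size (clan T i))%N.
Proof. by have := mem_clan i; case: clan. Qed.

Lemma root_descendants j : (ord0 \in descendants T j) = false.
Proof. by rewrite inE ltn0. Qed.

(** Together with [node_ind], this recursion determines the descendant relation;
    transitivity, comparability and uniqueness of parents all come from it. *)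
Lemma descendants_edge p i j : edge T p i ->
  (i \in descendants T j) = (j == p) || (p \in descendants T j).
Proof.
move=> pi; rewrite !inE (clan_edge pi) mem_rcons inE.
have [->|jp] := eqVneq j p; first by rewrite (edge_lt pi) mem_clan orbT.
have ltpi := edge_lt pi; apply/andP/andP => [[lt /orP[/eqP ji|jc]]|[lt jc]].
- by rewrite ji ltnn in lt.
- by split=> //; rewrite ltn_neqAle jp (mem_clan_le jc).
- by rewrite (ltn_trans lt ltpi) jc orbT.
Qed.

Lemma descendants_lt i j : j \in descendants T i -> (i < j)%N.
Proof. by rewrite inE => /andP[]. Qed.

Lemma descendants_irr i : (i \in descendants T i) = false.
Proof. by rewrite inE ltnn. Qed.

Lemma descendants_trans j i k :
  j \in descendants T i -> k \in descendants T j -> k \in descendants T i.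
Proof.
move=> ij; elim/node_ind: k => [|p k pk IHp]; first by rewrite root_descendants.
by rewrite !(descendants_edge _ pk) => /orP[/eqP <-|/IHp ->]; rewrite ?ij orbT.
Qed.

(** The strict ancestors of a node form a chain. *)
Lemma descendants_comparable i j k :
    k \in descendants T i -> k \in descendants T j ->
  [\/ i = j, i \in descendants T j | j \in descendants T i].
Proof.
elim/node_ind: k => [|p k pk IHp]; first by rewrite root_descendants.
rewrite !(descendants_edge _ pk) => /orP[/eqP ->|pi] /orP[/eqP ->|pj].
- exact: Or31.
- exact: Or32.
- exact: Or33.
- exact: IHp.
Qed.

Lemma edge_inj p q i : edge T p i -> edge T q i -> p = q.
Proof.
move=> pi qi; have : i \in descendants T p by rewrite (descendants_edge _ pi) eqxx.
have : i \in descendants T q by rewrite (descendants_edge _ qi) eqxx.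
rewrite (descendants_edge _ pi) => /predU1P[//|/descendants_lt qp].
rewrite (descendants_edge _ qi) => /predU1P[//|/descendants_lt pq].
by have := ltn_trans qp pq; rewrite ltnn.
Qed.

(** The weight for which x_p^d d_i, for an edge from p to i with multiplicity d,
    is homogeneous of degree zero; the bound in R_i says that x^j has weight at
    most the weight of the node. *)
Definition node_weight i : nat := clan_mult T i (size (clan T i)).-1.

Lemma node_weight_root : node_weight ord0 = 1%N.
Proof. by rewrite /node_weight clan_root /clan_mult big_ord0. Qed.

Lemma clan_mult_edge p i r : edge T p i -> (r < size (clan T p))%N ->
  clan_mult T i r = clan_mult T p r.
Proof.
move=> pi rp; apply: eq_bigr => t _; rewrite (clan_edge pi) !nth_rcons.
have tr := ltn_ord t.
by rewrite (ltn_trans tr rp) (leq_ltn_trans tr rp).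
Qed.

Lemma node_weight_edge p i :
  edge T p i -> node_weight i = (node_weight p * mult T p i)%N.
Proof.
move=> pi; have sp := clan_size_gt0 p.
rewrite /node_weight (clan_edge pi) size_rcons /= -(prednK sp).
rewrite {1}/clan_mult big_ord_recr /= -/(clan_mult T i _).
rewrite (clan_mult_edge pi) ?prednK //; congr (_ * mult T _ _)%N.
  rewrite (clan_edge pi) nth_rcons ltn_predL sp.
  have := xchooseP (clan_exists T p); rewrite -/(clan T p).
  case: (clan T p) => //= x c /and3P[_ _ /eqP <-].
  by rewrite (last_nth ord0).
by rewrite (clan_edge pi) nth_rcons ltnn eqxx.
Qed.

Lemma clan_multE i r : (r < size (clan T i))%N ->
  clan_mult T i r = node_weight (nth ord0 (clan T i) r).
Proof.
elim/node_ind: i r => [|p i pi IHp] r.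
  by rewrite clan_root; case: r => // _; rewrite node_weight_root /clan_mult big_ord0.
rewrite {1}(clan_edge pi) size_rcons ltnS leq_eqVlt => /orP[/eqP ->|rp].
  rewrite (clan_edge pi) nth_rcons ltnn eqxx /node_weight.
  by rewrite (clan_edge pi) size_rcons.
by rewrite (clan_mult_edge pi rp) IHp // (clan_edge pi) nth_rcons rp.
Qed.

Lemma node_weight_gt0 i : (0 < node_weight i)%N.
Proof.
elim/node_ind: i => [|p i pi IHp]; first by rewrite node_weight_root.
by rewrite (node_weight_edge pi) muln_gt0 IHp (mult_gt0 pi).
Qed.

Lemma node_weight_descendants i j :
  j \in descendants T i -> (node_weight i <= node_weight j)%N.
Proof.
elim/node_ind: j => [|p j pj IHp]; first by rewrite root_descendants.
rewrite (descendants_edge _ pj) (node_weight_edge pj) => ipj.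
have ip : (node_weight i <= node_weight p)%N by case/predU1P: ipj => [->|/IHp].
exact: leq_trans ip (leq_pmulr _ (mult_gt0 pj)).
Qed.

(** Below a node of Upsilon all multiplicities are 1, so weights stay constant. *)
Lemma node_weight_Upsilon i j :
  i \in Upsilon T -> j \in descendants T i -> node_weight j = node_weight i.
Proof.
rewrite inE => /forall_inP iU; elim/node_ind: j => [|p j pj IHp] ij.
  by rewrite root_descendants in ij.
have /existsP[q /and3P[_ qj /eqP qj1]] := iU _ ij.
rewrite (node_weight_edge pj) (edge_inj pj qj) qj1 muln1 -(edge_inj pj qj).
by move: ij; rewrite (descendants_edge _ pj) => /predU1P[->|/IHp].
Qed.

Definition monomial_weight m : nat := (\sum_j m j * node_weight j)%N.

Lemma monomial_weightD (b c : 'X_{1..n.+1}) :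
  monomial_weight (b + c) = (monomial_weight b + monomial_weight c)%N.
Proof.
by rewrite -big_split; apply: eq_bigr => j _; rewrite mnmDE mulnDl.
Qed.

Lemma monomial_weightU j r :
  monomial_weight (U_(j) *+ r) = (r * node_weight j)%N.
Proof.
rewrite /monomial_weight (bigD1 j) //= big1 ?addn0 => [|l /negbTE lj].
  by rewrite mulmnE mnm1E eqxx mul1n.
by rewrite mulmnE mnm1E eq_sym lj.
Qed.

Lemma monomial_weight0 : monomial_weight 0 = 0%N.
Proof. by rewrite /monomial_weight big1 // => j _; rewrite mnm0E. Qed.

Lemma monomial_weight_ge m j : (m j * node_weight j <= monomial_weight m)%N.
Proof. by rewrite /monomial_weight (bigD1 j) //= leq_addr. Qed.

Lemma monomial_weight_eq0 m : monomial_weight m = 0%N -> m = 0%MM.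
Proof.
move=> m0; apply/mnmP => j; rewrite mnm0E.
have := monomial_weight_ge m j; rewrite m0 leqn0 muln_eq0 => /orP[/eqP //|].
by have := node_weight_gt0 j; case: node_weight.
Qed.

Definition on_ancestors i m : Prop :=
  forall j, m j != 0%N -> i \in descendants T j.

Lemma on_ancestors_edge p i m : edge T p i -> on_ancestors i m ->
  exists2 m', m = (U_(p) *+ m p + m')%MM & on_ancestors p m'.
Proof.
move=> pi mi; exists [multinom (if j == p then 0%N else m j) | j < n.+1].
  apply/mnmP => j; rewrite mnmDE mulmnE mnm1E mnmE eq_sym.
  by have [->|_] := eqVneq j p; rewrite ?mul1n ?mul0n ?addn0.
move=> j; rewrite mnmE; have [//|jp /mi] := eqVneq j p.
by rewrite (descendants_edge _ pi) (negbTE jp).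
Qed.

(** Greedy packing: the weights of the ancestors divide one another along the
    clan, so after packing the parent variable x_q into the first part as far as
    it goes, what is left of both bounds is still a multiple of the weight of q,
    and the remaining variables are packed by induction. *)
Lemma monomial_split p m x y : on_ancestors p m ->
    (monomial_weight m <= (x + y) * node_weight p)%N ->
  exists b c, [/\ m = (b + c)%MM, (monomial_weight b <= x * node_weight p)%N &
    (monomial_weight c <= y * node_weight p)%N].
Proof.
elim/node_ind: p m x y => [|q p qp IHq] m x y mp.
  suff -> : m = 0%MM.
    by exists 0%MM, 0%MM; rewrite addm0 monomial_weight0.
  apply/mnmP => j; rewrite mnm0E; apply: contraFeq (root_descendants j).
  exact: mp.
have [m' -> m'q] := on_ancestors_edge qp mp.
rewrite (node_weight_edge qp) monomial_weightD monomial_weightU.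
move: (m q) (mult T q p) (node_weight_gt0 q) => r d w0 hm.
(* The first part, of capacity x * d in units of the weight of q, takes as many
   copies of x_q as fit; [hr] below ensures that the rest fits in the second. *)
pose r1 := minn r (x * d); pose r2 := (r - r1)%N.
have [b' [c' [-> hb hc]]] : exists b c, [/\ m' = (b + c)%MM,
   (monomial_weight b <= (x * d - r1) * node_weight q)%N &
   (monomial_weight c <= (y * d - r2) * node_weight q)%N].
  apply: IHq => //; rewrite -(leq_add2l (r * node_weight q)%N).
  apply: leq_trans hm _; rewrite -mulnDl (mulnC _ d) mulnA leq_mul2r.
  by apply/orP; right; rewrite mulnDl /r2 /r1; lia.
have hr : (r * node_weight q <= (x * d + y * d) * node_weight q)%N.
  by apply: leq_trans (leq_addr _ _) (leq_trans hm _); rewrite -mulnDl (mulnC _ d) mulnA.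
rewrite leq_mul2r -[_ == 0%N]negbK -lt0n w0 /= in hr.
exists (U_(q) *+ r1 + b')%MM, (U_(q) *+ r2 + c')%MM; split.
- apply/mnmP => l; rewrite !mnmDE !mulmnE addnACA -mulnDr.
  by congr (_ * _ + _)%N; rewrite /r2 /r1; lia.
- rewrite monomial_weightD monomial_weightU (mulnC _ d) mulnA.
  apply: leq_trans (leq_add (leqnn _) hb) _; rewrite -mulnDl leq_mul2r.
  by apply/orP; right; rewrite /r1; lia.
- rewrite monomial_weightD monomial_weightU (mulnC _ d) mulnA.
  apply: leq_trans (leq_add (leqnn _) hc) _; rewrite -mulnDl leq_mul2r.
  by apply/orP; right; rewrite /r2 /r1; lia.
Qed.

(** The exponents of R_i, read as multinomials in all variables. *)
Definition admissible i m : Prop :=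
  on_ancestors i m /\ (monomial_weight m <= node_weight i)%N.

End Tree.

(** * Monomials along a clan *)

Section ClanMonomials.
Variables (K : fieldType) (n : nat) (T : tree_diagram n).
Implicit Types (i j p s : 'I_n.+1) (m : 'X_{1..n.+1}) (a : seq nat).

Lemma clan_ancestors i : exists c,
  [/\ clan T i = rcons c i, uniq c & forall j, (j \in c) = (i \in descendants T j)].
Proof.
elim/(@node_ind _ T): i => [|p i pi [c [cE cU cD]]].
  by exists [::]; rewrite clan_root; split=> // j; rewrite root_descendants.
exists (clan T p); split=> [||j]; first exact: clan_edge.
  by rewrite cE rcons_uniq cU andbT cD descendants_irr.
by rewrite (descendants_edge _ pi) cE mem_rcons inE cD.
Qed.

Lemma big_ancestors (R : Type) (idx : R) (op : Monoid.com_law idx) i 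
    (c : seq 'I_n.+1) (F : 'I_n.+1 -> R) :
    uniq c -> (forall j, (j \in c) = (i \in descendants T j)) ->
    (forall j, i \notin descendants T j -> F j = idx) ->
  \big[op/idx]_j F j = \big[op/idx]_(r < size c) F (nth ord0 c r).
Proof.
move=> cU cD F0; rewrite -(big_mkord xpredT (fun r => F (nth ord0 c r))).
rewrite -(big_nth ord0 xpredT).
rewrite [RHS]big_uniq // [RHS]big_mkcond; apply: eq_bigr => j _.
by case: ifPn => //; rewrite cD; exact: F0.
Qed.

(** An exponent vector along the clan and a multinomial supported on the
    ancestors are the same data, with the same monomial and the same bound. *)
Lemma clan_monomial_map i c m : clan T i = rcons c i -> uniq c ->
    (forall j, (j \in c) = (i \in descendants T j)) -> on_ancestors T i m ->
  clan_monomial K T i [seq m j | j <- c] = 'X_[m] /\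
  exponents T i [seq m j | j <- c] = (monomial_weight T m <= node_weight T i)%N.
Proof.
move=> cE cU cD mi.
have m0 j : i \notin descendants T j -> m j = 0%N.
  by move=> ij; apply: contraNeq ij => /mi.
split.
  rewrite mpolyXE_id (big_ancestors _ cU cD) => [|j /m0 ->]; last by rewrite expr0.
  rewrite /clan_monomial size_map; apply: eq_bigr => r _.
  by rewrite cE nth_rcons ltn_ord (nth_map ord0).
rewrite /exponents size_map cE size_rcons eqxx /= -/(node_weight T i).
congr (_ <= _)%N; last by rewrite /node_weight cE size_rcons.
rewrite /monomial_weight (big_ancestors _ cU cD) => [|j /m0 -> //].
apply: eq_bigr => r _; rewrite (nth_map ord0) // clan_multE.
  by rewrite cE nth_rcons ltn_ord.
by rewrite cE size_rcons ltnS ltnW.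
Qed.

Lemma clan_monomial_admissible i a : exponents T i a ->
  exists2 m, admissible T i m & clan_monomial K T i a = 'X_[m].
Proof.
have [c [cE cU cD]] := clan_ancestors i.
move=> ia; have /andP[/eqP sa _] := ia; rewrite cE size_rcons /= in sa.
pose m : 'X_{1..n.+1} := [multinom nth 0%N a (index j c) | j < n.+1].
have mi : on_ancestors T i m.
  move=> j; rewrite -cD mnmE; apply: contraNT => jc.
  by rewrite memNindex // nth_default // sa.
have am : a = [seq m j | j <- c].
  apply: (@eq_from_nth _ 0%N) => [|r ra]; first by rewrite size_map.
  by rewrite (nth_map ord0) -?sa // mnmE index_uniq -?sa.
have [mE eE] := clan_monomial_map cE cU cD mi.
by exists m; rewrite ?am //; split=> //; rewrite -eE -am.
Qed.

Lemma admissible_clan_monomial i m : admissible T i m ->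
  exists2 a, exponents T i a & clan_monomial K T i a = 'X_[m].
Proof.
have [c [cE cU cD]] := clan_ancestors i => -[mi mw].
have [mE eE] := clan_monomial_map cE cU cD mi.
by exists [seq m j | j <- c]; rewrite ?eE.
Qed.

(** The pairs (s, m) such that x^m d_s is among the spanning fields of I(S). *)
Definition ideal_pair (S : {set 'I_n.+1}) s m : Prop :=
  exists i, [/\ i \in S, admissible T i m & s = i \/ s \in descendants T i].

Lemma ideal_ofE (S : {set 'I_n.+1}) :
  @ideal_of K n T S = vfields_on (ideal_pair S).
Proof.
rewrite -span_monf; congr (span _); apply/seteqP; split=> D /=.
  move=> [i [a [s [iS /clan_monomial_admissible[m im ->] si ->]]]].
  by exists s, m; split=> //; exists i.
move=> [s [m [[i [iS im si]] ->]]].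
have [a ia mE] := admissible_clan_monomial im.
by exists i, a, s; rewrite mE.
Qed.
End ClanMonomials.

(** * The Lie algebras of a tree diagram and the ideals I(S) *)

Section LieAlgebra.
Variables (K : numFieldType) (n : nat) (T : tree_diagram n).
Implicit Types (i j p s : 'I_n.+1) (a b m : 'X_{1..n.+1}) (S : {set 'I_n.+1}).
Local Notation adm := (admissible T).

Lemma admissible0 i : adm i 0%MM.
Proof. by split=> [j|]; rewrite ?mnm0E ?eqxx // monomial_weight0. Qed.

(** Differentiating x^(b + U_i) by x^a d_i trades x_i for x^a, which is no heavier. *)
Lemma admissible_bracket i a s b :
  adm i a -> adm s (b + U_(i))%MM -> adm s (a + b)%MM.
Proof.
move=> [ai aw] [bs bw].
have si : s \in descendants T i.
  by apply: bs; rewrite mnmDE mnm1E eqxx addn1.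
split.
  move=> j; rewrite mnmDE addn_eq0 negb_and => /orP[/ai ij|bj].
    exact: descendants_trans ij si.
  by apply: bs; rewrite mnmDE addn_eq0 negb_and bj.
move: bw; rewrite !monomial_weightD -[U_(i)%MM]mulm1n monomial_weightU mul1n.
by lia.
Qed.

Lemma admissible_mulX p i b r : edge T p i -> on_ancestors T p b ->
    (r <= mult T p i)%N ->
    (monomial_weight T b <= (mult T p i - r) * node_weight T p)%N ->
  adm i (b + U_(p) *+ r)%MM.
Proof.
move=> pi bp rd bw; split.
  move=> j; rewrite mnmDE mulmnE mnm1E (descendants_edge _ pi).
  by have [->//|_] := eqVneq p j; rewrite mul0n addn0 => /bp ->; rewrite orbT.
rewrite monomial_weightD monomial_weightU (node_weight_edge pi).
apply: leq_trans (leq_add bw (leqnn _)) _.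
by rewrite -mulnDl subnK // mulnC.
Qed.

Lemma lie_subalgebra_admissible : lie_subalgebra (@vfields_on K _ adm).
Proof.
split; first exact: diffops_vfields_on.
  exact: subspace_vfields_on.
by move=> D E; apply: bracket_vfields_on => i a s b; exact: admissible_bracket.
Qed.

Lemma vfield1 i : vfield 1 i = monf 0%MM i :> operator K n.+1.
Proof. by rewrite /monf mpolyX0. Qed.

Lemma vfieldX p i r :
  vfield ('X_p ^+ r) i = monf (U_(p) *+ r)%MM i :> operator K n.+1.
Proof. by rewrite /monf mpolyXn. Qed.

Lemma admissible_edge p i : edge T p i -> adm i (U_(p) *+ mult T p i)%MM.
Proof.
move=> pi; rewrite -[X in adm _ X]add0m; apply: admissible_mulX => //.
  by move=> j; rewrite mnm0E eqxx.
by rewrite monomial_weight0.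
Qed.

(** For an edge from p to i with multiplicity d, a general x^b x_p^(d-t) d_i with b
    of weight at most t times that of p is obtained from the generator x_p^d d_i
    by t brackets: each one replaces a factor x_p by a monomial x^b1 with x^b1 d_p
    already available, and [monomial_split] provides the t pieces of b. *)
Lemma lie_generated_monf (L : set (operator K n.+1)) : lie_subalgebra L ->
    L (vfield 1 ord0) ->
    (forall i j, edge T i j -> L (vfield ('X_i ^+ mult T i j) j)) ->
  forall i m, adm i m -> L (monf m i).
Proof.
move=> [_ sL bL] L1 Le; elim/(@node_ind _ T) => [|p i pi IHp] m [mi mw].
  suff -> : m = 0%MM by rewrite -vfield1.
  apply/mnmP => j; rewrite mnm0E; apply: contraFeq (root_descendants T j).
  exact: mi.
(* t counts the factors x_p of the generator that have been replaced. *)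
have gen t : (t <= mult T p i)%N -> forall b, on_ancestors T p b ->
    (monomial_weight T b <= t * node_weight T p)%N ->
    L (monf (b + U_(p) *+ (mult T p i - t))%MM i).
  elim: t => [_ b bp|t IHt td b bp bw].
    rewrite mul0n leqn0 => /eqP /monomial_weight_eq0 ->.
    by rewrite add0m subn0 -vfieldX; exact: Le.
  have [|b1 [b2 [bE b1w b2w]]] := @monomial_split _ T p b 1 t bp.
    by rewrite add1n.
  rewrite mul1n in b1w.
  have b1p : on_ancestors T p b1.
    by move=> j b1j; apply: bp; rewrite bE mnmDE addn_eq0 negb_and b1j.
  have b2p : on_ancestors T p b2.
    by move=> j b2j; apply: bp; rewrite bE mnmDE addn_eq0 negb_and b2j orbT.
  have := bL _ _ (IHp b1 (conj b1p b1w)) (IHt (ltnW td) b2 b2p b2w).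
  have -> : (b2 + U_(p) *+ (mult T p i - t) =
             b2 + U_(p) *+ (mult T p i - t.+1) + U_(p))%MM.
    by rewrite -addmA -mulmSr subnSK.
  rewrite bracket_monf; last first.
    apply/eqP; apply: contraFT (descendants_irr T i) => /b1p ip.
    by have := ltn_trans (edge_lt pi) (descendants_lt ip); rewrite ltnn.
  by rewrite bE -addmA => /subspaceZ_neq0; apply; rewrite ?pnatr_eq0.
have [b mE bp] := on_ancestors_edge pi mi.
have mw' := mw.
rewrite mE monomial_weightD monomial_weightU (node_weight_edge pi) in mw'.
have md : (m p <= mult T p i)%N.
  rewrite -(leq_pmul2r (node_weight_gt0 T p)) [X in (_ <= X)%N]mulnC.
  exact: leq_trans (leq_addr _ _) mw'.
rewrite mE addmC -[X in (U_(p) *+ X)%MM](subKn md); apply: gen => //.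
  exact: leq_subr.
by rewrite mulnBl leq_subRL ?leq_mul2r ?md ?orbT // [X in (_ <= X)%N]mulnC.
Qed.

(** The admissible fields are closed under bracket and contain the generators;
    conversely they are all generated. *)
Lemma L0E : @L0 K n T = vfields_on adm.
Proof.
apply/seteqP; split=> D.
  apply; first exact: lie_subalgebra_admissible.
  move=> _ [->|[i [j [ij ->]]]].
    by rewrite vfield1; apply: monf_in; exact: admissible0.
  by rewrite vfieldX; apply: monf_in; exact: admissible_edge.
move=> DA L sL GL; have [_ subL _] := sL.
apply: vfields_on_sub DA => //; apply: lie_generated_monf => //.
  by apply: GL; left.
by move=> i j ij; apply: GL; right; exists i, j.
Qed.

Lemma HE : @H K n = vfields_on (fun i m => m = U_(i)%MM).
Proof.
rewrite -span_monf; congr (span _); apply/seteqP; split=> D /=.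
  by move=> [i ->]; exists i, U_(i)%MM.
by move=> [i [m [-> ->]]]; exists i.
Qed.

Definition L1_pair i m : Prop := m = U_(i)%MM \/ adm i m.

Lemma L1_sub : L1 (K := K) T `<=` vfields_on L1_pair.
Proof.
move=> D [D1 [D2 []]]; rewrite HE L0E => D1H D2L ->.
apply: subspaceD; first exact: subspace_vfields_on.
  by apply: vfields_onS D1H; left.
by apply: vfields_onS D2L; right.
Qed.

Lemma L1_admissible : vfields_on adm `<=` L1 (K := K) T.
Proof.
move=> D DA; exists 0, D; split; rewrite ?add0r ?L0E //.
by have [] := subspace_span [set D | exists i, D = @vfield K _ 'X_i i].
Qed.

Lemma L1_euler i : L1 (K := K) T (monf U_(i)%MM i).
Proof.
exists (monf U_(i)%MM i), 0; split; rewrite ?addr0 ?L0E ?HE //.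
  exact: monf_in.
by have [] := subspace_vfields_on K adm.
Qed.

Lemma ideal_pair_admissible S s m : ideal_pair T S s m -> adm s m.
Proof.
move=> [i [_ im [->//|ds]]]; case: im => mi mw; split.
  by move=> j /mi ij; exact: descendants_trans ij ds.
exact: leq_trans mw (node_weight_descendants ds).
Qed.

(** Differentiating an element of the ideal stays in it by [admissible_bracket].
    When x^a d_i in the ideal differentiates x^b x_i d_s, the node s lies below i,
    hence has the same weight as i, which forces b = 0.  Two elements of the
    ideal commute because variables in the coefficients belong to strict
    ancestors of S, whereas the derivatives point to S or below. *)
Lemma ideal_of_abelian S : independent T S -> S \subset Upsilon T ->
  abelian_ideal (L1 T) (@ideal_of K n T S).
Proof.
move=> Sind SU; rewrite ideal_ofE; split.
- move=> D DS; apply/L1_admissible/(vfields_onS _ DS) => i m.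
  exact: ideal_pair_admissible.
- exact: subspace_vfields_on.
- move=> D E /L1_sub; apply: bracket_vfields_on => i a s b.
    move=> [->|ia] [t [tS tb st]]; exists t; split=> //; first by rewrite addmC.
    exact: admissible_bracket tb.
  move=> [t [tS ta it]] [bs|[bs bw]].
    have si : s = i.
      have := congr1 (fun m : 'X_{1..n.+1} => m i) bs.
      by rewrite mnmDE !mnm1E eqxx addn1; case: eqP.
    have -> : b = 0%MM by apply: (@addIm _ U_(i)%MM); rewrite bs si add0m.
    by rewrite addm0 si; exists t.
  have si : s \in descendants T i by apply: bs; rewrite mnmDE mnm1E eqxx addn1.
  have st : s \in descendants T t.
    by case: it => [<- //|it]; exact: descendants_trans it si.
  have tU : t \in Upsilon T by exact: (fintype.subsetP SU).
  have wi : node_weight T i = node_weight T t.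
    by case: it => [-> //|it]; exact: node_weight_Upsilon.
  suff -> : b = 0%MM by rewrite addm0; exists t; split=> //; right.
  apply: monomial_weight_eq0 (T) _ _.
  move: bw; rewrite monomial_weightD -[U_(i)%MM]mulm1n monomial_weightU mul1n.
  by rewrite (node_weight_Upsilon tU st) wi; lia.
- move=> D E DS ES.
  have : vfields_on (fun _ _ => False) (bracket D E).
    have no i a s b : ideal_pair T S i a ->
        ideal_pair T S s (b + U_(i))%MM -> False.
      move=> [t [tS _ it]] [u [uS [bu _] _]].
      have ui : u \in descendants T i by apply: bu; rewrite mnmDE mnm1E eqxx addn1.
      have ut : u \in descendants T t.
        by case: it => [<- //|it]; exact: descendants_trans it ui.
      by move/forall_inP/(_ t tS)/forall_inP/(_ u uS): Sind; rewrite ut.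
    by apply: bracket_vfields_on DS ES.
  apply: (vfields_on_sub (V := [set 0])) => //.
  by split=> // k _ _ -> ->; rewrite scaler0 addr0.
Qed.

End LieAlgebra.

(** * Abelian ideals *)

Section AbelianIdeals.
Variables (K : numFieldType) (n : nat) (T : tree_diagram n).
Variable I : set (operator K n.+1).
Hypothesis abI : abelian_ideal (L1 T) I.
Implicit Types (i j p s : 'I_n.+1) (a b m : 'X_{1..n.+1}) (S : {set 'I_n.+1}).
Implicit Types F : 'I_n.+1 -> {mpoly K[n.+1]}.

Let sI : subspace I. Proof. by case: abI. Qed.

Lemma L1_partial i : L1 T (@monf K _ 0%MM i).
Proof. by apply/L1_admissible/monf_in/admissible0. Qed.

Lemma ideal_bracket D E : L1 T D -> I E -> I (bracket D E).
Proof. by case: abI => _ _ h _; exact: h. Qed.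

Lemma ideal_commute D E : I D -> I E -> bracket D E = 0.
Proof. by case: abI => _ _ _; exact. Qed.

Lemma ideal_coef_pair F i m : I (vf F) -> (F i)@_m != 0 -> L1_pair T i m.
Proof.
case: abI => IL _ _ _ /IL/L1_sub[G /vf_inj FG GP].
by rewrite FG; exact: GP.
Qed.

Lemma admissible_diag i m : admissible T i m -> m i = 0%N.
Proof.
by move=> [mi _]; apply/eqP; apply: contraFT (descendants_irr T i); exact: mi.
Qed.

(** A weight with a coordinate -1 belongs to a single pair of L_1: the x_k d_k have
    weight zero, and for admissible x^m d_i the coordinate i is the only negative
    one, so the weight determines i and then m. *)
Lemma monf_of_coef F i m :
  I (vf F) -> (F i)@_m != 0 -> m i = 0%N -> I (monf m i).
Proof.
move=> IF Fim mi; apply: (monf_mem_of_weight (F := F)) => //.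
  by move=> k D; apply: ideal_bracket; exact: L1_euler.
move=> i' m' F' w; have := w i; rewrite /weight eqxx mi.
case: (ideal_coef_pair IF F') => [->|/admissible_diag m'i'].
  by rewrite mnm1E (eq_sym i') subrr sub0r => /esym/eqP; rewrite oppr_eq0 oner_eq0.
have [ii'|_] := eqVneq i i'.
  rewrite -ii' in w *; move=> _; split=> //.
  by apply/mnmP => k; have /addIr/eqP := w k; rewrite eqr_nat => /eqP.
rewrite subr0 sub0r => /eqP; rewrite -addr_eq0 -mulrSr pnatr_eq0; by [].
Qed.

Lemma bracket_partial i F :
  bracket (monf 0%MM i) (vf F) = vf (fun s => mderiv i (F s)).
Proof.
rewrite /monf vfieldE bracket_vf; apply: vf_ext => s.
rewrite -vfieldE /vfield mpolyX0 mul1r.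
suff -> : vf F (if s == i then 1 else 0) = 0 by rewrite subr0.
by rewrite /vf big1 // => j _; case: ifP => _; rewrite ?mderivC ?mderiv0 mulr0.
Qed.

(** If x_i d_i occurred in an element D of I, then [d_i, D] in I would have a nonzero
    coefficient at d_i, so d_i would be in I; but d_i does not commute with D. *)
Lemma ideal_coef_euler F i : I (vf F) -> (F i)@_U_(i) = 0.
Proof.
move=> IF; apply: contrapT => /eqP Fi.
(* The coefficient of d_i in [d_i, D]. *)
have dF : (mderiv i (F i))@_0 != 0 by rewrite mcoeff_deriv mnm0E add0m mulr1n.
have Ii : I (monf 0%MM i).
  have := ideal_bracket (L1_partial i) IF; rewrite bracket_partial.
  by move/monf_of_coef; apply; rewrite ?mnm0E.
have : vf (fun s => mderiv i (F s)) = vf (fun=> 0).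
  rewrite -bracket_partial ideal_commute //; apply: funext => p.
  by rewrite /vf big1 // => s _; rewrite mul0r.
by move/vf_inj => h; move: dF; rewrite h mcoeff0 eqxx.
Qed.

Lemma ideal_coef F i m :
  I (vf F) -> (F i)@_m != 0 -> admissible T i m /\ I (monf m i).
Proof.
move=> IF Fim; have [mU|im] := ideal_coef_pair IF Fim.
  by rewrite mU ideal_coef_euler ?eqxx in Fim.
by split=> //; apply: monf_of_coef IF Fim _; exact: admissible_diag.
Qed.

(** Differentiating an element of I by the d_j leads to one of these d_i, so this
    set of nodes constrains all of I. *)
Definition partials : {set 'I_n.+1} := [set i | `[< I (monf 0%MM i) >]]%SET.

Lemma partialsP i : reflect (I (monf 0%MM i)) (i \in partials).
Proof. by rewrite inE; exact: asboolP. Qed.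

Lemma bracket_partial_monf j b i :
  bracket (monf 0%MM j) (monf (b + U_(j)) i) =
    (b j).+1%:R *: monf b i :> operator K n.+1.
Proof. by rewrite bracket_monf ?mnm0E // add0m. Qed.

Lemma mnm_pred m j : m j != 0%N -> exists b, m = (b + U_(j))%MM.
Proof.
move=> mj; exists (m - U_(j))%MM; apply/mnmP => l.
by rewrite mnmDE mnmBE mnm1E; case: eqP => [<-|_] /=; lia.
Qed.

Lemma monf_neq0 m i : monf m i <> 0 :> operator K n.+1.
Proof.
move=> m0; apply: (@monf_inv K _ (fun _ _ => False) m i); rewrite m0.
by have [] := subspace_vfields_on K (fun (_ : 'I_n.+1) (_ : 'X_{1..n.+1}) => False).
Qed.

(** Differentiating x^m d_i down to a constant coefficient stays in the ideal. *)
Lemma ideal_monf_partial m i : I (monf m i) -> i \in partials.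
Proof.
have [d] := ubnP (mdeg m); elim: d m => // d IHd m md Im.
have [m0|/eqP m0] := eqVneq (mdeg m) 0%N.
  by move/eqP: m0; rewrite mdeg_eq0 => /eqP m0; apply/partialsP; rewrite -m0.
have [j mj] : exists j, m j != 0%N.
  apply: contra_notP m0 => /forallNP m0; rewrite mdegE big1 // => j _.
  by have /negP := m0 j; rewrite negbK => /eqP.
have [b mb] := mnm_pred mj; rewrite mb in Im md.
apply: (IHd b); first by move: md; rewrite mdegD mdeg1 addn1 ltnS.
have := ideal_bracket (L1_partial j) Im; rewrite bracket_partial_monf.
by move/subspaceZ_neq0; apply; rewrite ?pnatr_eq0.
Qed.

(** Otherwise d_j and x^m d_i would be two elements of I that do not commute. *)
Lemma ideal_monf_avoid m i j : I (monf m i) -> j \in partials -> m j = 0%N.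
Proof.
move=> Im /partialsP Ij; apply: contrapT => /eqP /mnm_pred[b mb].
have := ideal_commute Ij Im; rewrite mb bracket_partial_monf => b0.
apply: (@monf_neq0 b i); apply: (@subspaceZ_neq0 _ _ [set 0] (b j).+1%:R) => //.
  by split=> // k _ _ -> ->; rewrite scaler0 addr0.
by rewrite pnatr_eq0.
Qed.

Lemma ideal_bracket_partial b i s : I (monf 0%MM i) -> b s = 0%N ->
  admissible T s (b + U_(i))%MM -> I (monf b s).
Proof.
move=> Ii bs /(@monf_in K _ (admissible T))/L1_admissible/ideal_bracket/(_ Ii).
rewrite bracket_skew bracket_partial_monf -scaleNr => /subspaceZ_neq0; apply=> //.
by rewrite oppr_eq0 pnatr_eq0.
Qed.

(** For s below i, the field x_i d_s is admissible and [x_i d_s, d_i] = - d_s. *)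
Lemma partials_descendants i s :
  i \in partials -> s \in descendants T i -> s \in partials.
Proof.
move=> /partialsP Ii ds; apply/partialsP.
apply: ideal_bracket_partial Ii _ _; rewrite ?mnm0E // add0m; split.
  by move=> j; rewrite mnm1E; have [<-|] := eqVneq i j.
rewrite -[U_(i)%MM]mulm1n monomial_weightU mul1n.
exact: node_weight_descendants.
Qed.

(** If the edge from p to s had multiplicity d > 1 with d_p in I, then the bracket
    of x_p^d d_s with d_p would put x_p^(d-1) d_s in I, which does not commute
    with d_p. *)
Lemma partials_Upsilon : partials \subset Upsilon T.
Proof.
apply/fintype.subsetP => i iI; rewrite inE; apply/forall_inP => s.
elim/(@node_ind _ T): s => [|p s ps _]; first by rewrite root_descendants.
rewrite (descendants_edge _ ps) => ip.
have pI : p \in partials.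
  by case/predU1P: ip => [<- //|]; exact: partials_descendants.
apply/existsP; exists p; rewrite (edge_lt ps) ps /=.
apply: contraT => d1; have := mult_gt0 ps.
case dE : (mult T p s) d1 => [//|[//|d]] _ _.
have sp : s != p by apply: contraTneq (edge_lt ps) => ->; rewrite ltnn.
have : I (monf (U_(p) *+ d.+1)%MM s).
  apply: ideal_bracket_partial (elimT (partialsP p) pI) _ _.
    by rewrite mulmnE mnm1E eq_sym (negbTE sp).
  by rewrite addmC -mulmS -dE; exact: admissible_edge.
move/ideal_monf_avoid/(_ pI); by rewrite mulmnE mnm1E eqxx.
Qed.

(** As [partials] is closed under descendants, it is recovered from these nodes,
    which form the set S with I contained in I(S). *)
Definition top_partials : {set 'I_n.+1} :=
  [set i in partials | [forall j in partials, i \notin descendants T j]]%SET.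

Lemma top_partials_independent : independent T top_partials.
Proof.
apply/forall_inP => i; rewrite inE => /andP[iI _]; apply/forall_inP => j.
by rewrite inE => /andP[_ /forall_inP]; exact.
Qed.

Lemma top_partials_sub : top_partials \subset Upsilon T.
Proof.
apply: fintype.subset_trans partials_Upsilon; apply/fintype.subsetP => i.
by rewrite inE => /andP[].
Qed.

Lemma partials_top s : s \in partials ->
  exists2 i, i \in top_partials & s = i \/ s \in descendants T i.
Proof.
have [d] := ubnP (nat_of_ord s); elim: d s => // d IHd s sd ps.
have [/forall_inP sm|] := boolP [forall j in partials, s \notin descendants T j].
  by exists s; [rewrite inE ps; exact/forall_inP|left].
rewrite negb_forall_in => /exists_inP[j jI]; rewrite negbK => js.
have [|i iS ij] := IHd j _ jI; first exact: leq_trans (descendants_lt js) sd.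
exists i => //; right; case: ij => [<- //|ij].
exact: descendants_trans ij js.
Qed.

(** Let x^m d_s be in I and let i be the top node above s.  The variables in x^m
    belong to ancestors of s outside [partials], hence above i, and s has the
    weight of i, so m is an exponent of R_i. *)
Lemma abelian_ideal_sub : I `<=` ideal_of T top_partials.
Proof.
move=> D ID; have [IL _ _ _] := abI; rewrite ideal_ofE.
have [F DF _] := L1_sub (IL _ ID); exists F => // s m Fsm.
rewrite DF in ID; have [[ms mw] Im] := ideal_coef ID Fsm.
have [i iS si] := partials_top (ideal_monf_partial Im).
have iI : i \in partials by move: iS; rewrite inE => /andP[].
exists i; split=> //; case: si => [<- //|si]; split; last first.
  by rewrite -(node_weight_Upsilon _ si) // (fintype.subsetP top_partials_sub).
move=> j mj; have jI : j \notin partials.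
  by apply: contraNN mj => jI; apply/eqP; exact: ideal_monf_avoid Im jI.
have [ji|ji|//] := descendants_comparable (ms j mj) si.
  by rewrite ji iI in jI.
by rewrite (partials_descendants iI ji) in jI.
Qed.
End AbelianIdeals.

Lemma ideal_ofS (K : fieldType) n (T : tree_diagram n) (S S' : {set 'I_n.+1}) :
  S \subset S' -> @ideal_of K n T S `<=` ideal_of T S'.
Proof.
move=> SS'; rewrite !ideal_ofE; apply: vfields_onS => s m [i [iS im si]].
by exists i; rewrite (fintype.subsetP SS').
Qed.

(** A node s of S' gives d_s in I(S), so s is in S or below it; the latter is
    excluded by independence of S'. *)
Lemma ideal_of_inj_sub (K : fieldType) n (T : tree_diagram n) (S S' : {set 'I_n.+1}) :
  independent T S' -> S \subset S' -> @ideal_of K n T S' `<=` ideal_of T S -> S' = S.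
Proof.
move=> S'ind SS' II; apply/eqP; rewrite finset.eqEsubset SS' andbT.
apply/fintype.subsetP => s sS'.
have : ideal_pair T S s 0%MM.
  apply: (@monf_inv K); rewrite -ideal_ofE; apply: II.
  rewrite ideal_ofE; apply: monf_in; exists s; split=> //; last by left.
  by split=> [j|]; rewrite ?mnm0E ?eqxx // monomial_weight0.
move=> [i [iS _ [-> //|ds]]].
by move/forall_inP/(_ i (fintype.subsetP SS' _ iS))/forall_inP/(_ s sS'): S'ind; rewrite ds.
Qed.

Theorem theorem2p6 (R : realType) (n : nat) (T : tree_diagram n)
    (I : set (operator (complex R) n.+1)) :
  maximal_abelian_ideal (L1 T) I ->
  exists S : {set 'I_n.+1},
    maximal_independent_Upsilon T S /\ I = ideal_of T S.
Proof.
move=> [abI maxI]; pose S := top_partials T I.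
have Sind : independent T S := top_partials_independent T I.
have SU : S \subset Upsilon T := top_partials_sub abI.
have IE : ideal_of T S = I.
  by apply: maxI; [exact: ideal_of_abelian|exact: abelian_ideal_sub].
exists S; split=> //; apply/maxsetP; split; first by rewrite Sind SU.
move=> S' /andP[S'ind S'U] SS'.
have IE' : ideal_of T S' = I.
  apply: maxI; first exact: ideal_of_abelian.
  by rewrite -IE; exact: ideal_ofS.
apply: (ideal_of_inj_sub S'ind SS' (K := complex R)).
by move=> D; rewrite IE' IE.
Qed.
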